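(* Let $d \ge 1$ and let $\{P_\theta\}_{\theta\in\Theta}$ be a generalized linear model of conditional distributions of $Y$ given $X=x \in \mathbb{R}^d$ of the form \[ dP_\theta(y \mid x) = \exp\big(y\,\theta^T x - A(\theta^T x)\big)\, d\nu(y), \] where $\nu$ is a base measure on the response space and $A$ is the corresponding log-partition function, with $0$ in the interior of $\operatorname{dom} A$. Let $\Theta \subset \mathbb{R}^d$ contain $0$ in its interior. For each $\theta\in\Theta$, let $P_\theta$ also denote the joint distribution of $(X,Y)$ in which $X \sim \mathrm{Uniform}(\{-1,1\}^d)$ and $Y \mid X = x \sim P_\theta(\cdot\mid x)$, with conditional density $p_\theta(y\mid x)$ with respect to $\nu$. For a conditional distribution (predictive density) $p(y\mid x)$ define the log-loss risk $R_P(p) = -\mathbb{E}_P[\log p(Y\mid X)]$ and $R_P^\star = \inf_p R_P(p)$, the infimum over all conditional distributions. Then there exists a numerical constant $c>0$ such that for all sufficiently large $n$, \[ \inf_{\widehat p_n} \sup_{\theta\in\Theta} \mathbb{E}_{P_\theta}^n\big[R_{P_\theta}(\widehat p_n) - R_{P_\theta}^\star\big] \ \ge\ c\,\frac{d}{n}, \] where the infimum is over all estimators $\widehat p_n$ that map $n$ i.i.d.\ samples $(X_i,Y_i)_{i=1}^n \sim P_\theta$ to an arbitrary conditional probability distribution of $Y$ given $X$ (not necessarily in the family $\{p_\theta\}$ or its convex hull), and $\mathbb{E}_{P_\theta}^n$ denotes expectation over the sample.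
   Context: The left-hand side is the minimax excess log-loss risk in the well-specified case (no misspecification), when the learner may play any probability distribution over $Y$ given $X$.
   Formalization: The base measure ν is additionally assumed not to be concentrated on a single point (nor zero); otherwise all P_θ coincide, a constant predictor has zero excess risk and the bound fails. Each θ in Θ is also taken with θᵀx in the interior of dom A, which is not needed. *)

(* Defs.v *)
From HB Require Import structures.
From mathcomp Require Import all_boot all_order all_algebra.
From mathcomp Require Import all_classical all_reals all_analysis.
Set Implicit Arguments. Unset Strict Implicit. Unset Printing Implicit Defensive.
Import Order.TTheory GRing.Theory Num.Theory.
Import numFieldNormedType.Exports.
Local Open Scope classical_set_scope.
Local Open Scope ring_scope.

(* Covariate space {-1,1}^d, coded by sign vectors: [true] = +1, [false] = -1. *)
Definition Xd (d : nat) := {ffun 'I_d -> bool}.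

Section GLM.
Variables (R : realType) (d : nat) (nu : {measure set R -> \bar R}).

Definition xcoord (x : Xd d) (i : 'I_d) : R := if x i then 1 else -1.

Definition dotx (theta : 'rV[R]_d) (x : Xd d) : R :=
  \sum_(i < d) theta 0 i * xcoord x i.

Definition Zpart (eta : R) : \bar R := (\int[nu]_y (expR (y * eta))%:E)%E.
Definition domA : set R := [set eta | (Zpart eta < +oo)%E].
Definition logpart (eta : R) : R := ln (fine (Zpart eta)).

Definition pdens (theta : 'rV[R]_d) (x : Xd d) (y : R) : R :=
  expR (y * dotx theta x - logpart (dotx theta x)).

Definition pred_density (q : Xd d -> R -> R) : Prop :=
  forall x, [/\ forall y, 0 <= q x y, measurable_fun setT (q x)
              & (\int[nu]_y (q x y)%:E = 1)%E].

Definition Ejoint (theta : 'rV[R]_d) (g : Xd d -> R -> \bar R) : \bar R :=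
  (((#|{: Xd d}|%:R)^-1)%:E *
     \sum_(x : Xd d) \int[nu]_y ((pdens theta x y)%:E * g x y))%E.

(* log-loss risk R_P(q) = - E_P [log q(Y|X)]  (with -log 0 = +oo) *)
Definition risk (theta : 'rV[R]_d) (q : Xd d -> R -> R) : \bar R :=
  Ejoint theta (fun x y => (- lne (q x y)%:E)%E).

Definition risk_star (theta : 'rV[R]_d) : \bar R :=
  ereal_inf [set risk theta q | q in pred_density].

Fixpoint int_resp (theta : 'rV[R]_d) (n : nat) :
    n.-tuple (Xd d) -> (n.-tuple R -> \bar R) -> \bar R :=
  match n with
  | 0 => fun _ g => g [tuple]
  | n'.+1 => fun xs g =>
      (\int[nu]_y ((pdens theta (thead xs) y)%:E *
          int_resp theta (behead_tuple xs) (fun t => g (cons_tuple y t))))%E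
  end.

Definition Esample (theta : 'rV[R]_d) (n : nat)
    (g : n.-tuple (Xd d) -> n.-tuple R -> \bar R) : \bar R :=
  (((#|{: n.-tuple (Xd d)}|%:R)^-1)%:E *
     \sum_(xs : n.-tuple (Xd d)) int_resp theta xs (g xs))%E.

Definition estimator (n : nat)
    (est : n.-tuple (Xd d) -> n.-tuple R -> Xd d -> R -> R) : Prop :=
  (forall xs ys, pred_density (est xs ys)) /\
  (forall xs x, measurable_fun setT
      (fun z : n.-tuple R * R => est xs z.1 x z.2)).

Definition expected_excess_risk (theta : 'rV[R]_d) (n : nat)
    (est : n.-tuple (Xd d) -> n.-tuple R -> Xd d -> R -> R) : \bar R :=
  Esample theta (fun xs ys => (risk theta (est xs ys) - risk_star theta)%E).

Definition minimax_excess_risk (Theta : set 'rV[R]_d) (n : nat) : \bar R :=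
  ereal_inf [set ereal_sup [set expected_excess_risk theta est | theta in Theta]
            | est in @estimator n].

End GLM.

(* Main.v *)
Require Import Defs.
From HB Require Import structures.
From mathcomp Require Import all_boot all_order all_algebra.
From mathcomp Require Import all_classical all_reals all_analysis.
From mathcomp Require Import measurable_realfun ring lra.
Set Implicit Arguments.
Unset Strict Implicit.
Unset Printing Implicit Defensive.
Import Order.TTheory GRing.Theory Num.Theory.
Import numFieldNormedType.Exports.
Local Open Scope classical_set_scope.
Local Open Scope ring_scope.

(* Assouad's argument in Hellinger space.  Along the cube of parameters
   theta_t = ep * t, t in {-1,1}^d, with sigma^2 * ep^2 = 1 / (2 n) and sigma^2
   the variance of the normalised base measure, the excess risk of q dominates
   the mean over x of the squared L2(nu) distance between sqrt p_theta and
   sqrt q.  The functions x_i * (y - mean) / sqrt V, with V the integral of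
   (y - mean)^2, are orthonormal in L2(Uniform * nu), so by Bessel the excess
   risk is at least sum_i (phi_i(t) - a_i(q))^2, where phi_i(t) is sigma * ep *
   t_i / 2 up to O(ep^2).  Flipping one coordinate of t moves phi_i by about
   sigma * ep while the n-sample Hellinger affinity stays at least
   (1 - sigma^2 * ep^2)^n >= 1/2, so no estimator recovers t_i: every coordinate
   contributes at least a constant times sigma^2 * ep^2, of order 1/n. *)

(** * Measurability and monotonicity of integrals *)

Lemma measurable_sqrt (R : realType) : measurable_fun setT (@Num.sqrt R).
Proof. exact: continuous_measurable_fun (@sqrt_continuous R). Qed.

(** The integral is a difference of suprema over simple functions lying under the positive and the
    negative part; raising [f] enlarges the first family and shrinks the second. Monotonicity thus
    applies to arbitrary functions, such as the excess risk as a function of the sample. *)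
Lemma le_integralT d (T : measurableType d) (R : realType)
    (mu : {measure set T -> \bar R}) (f g : T -> \bar R) :
  (forall x, f x <= g x)%E -> (\int[mu]_x f x <= \int[mu]_x g x)%E.
Proof.
move=> fg; rewrite /integral !patch_setT; apply: leeB.
- apply: ereal_sup_le => _ [h hf <-]; exists h => // x.
  apply: le_trans (hf x) _; rewrite !funeposE.
  by rewrite ge_max !le_max fg lexx orbT.
- apply: ereal_sup_le => _ [h hf <-]; exists h => // x.
  apply: le_trans (hf x) _; rewrite !funenegE.
  by rewrite ge_max !le_max leeN2 fg lexx orbT.
Qed.

Lemma measurable_integral_snd d (T : measurableType d) (R : realType)
    (nu : {measure set R -> \bar R}) (g : T * R -> \bar R) :
  (nu setT < +oo)%E -> measurable_fun setT g -> (forall z, 0 <= g z)%E ->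
  measurable_fun setT (fun t => \int[nu]_y g (t, y))%E.
Proof.
move=> nufin mg g0.
have nuF : fin_num_fun nu.
  move=> A mA; rewrite ge0_fin_numE//; apply: le_lt_trans nufin.
  by apply: le_measure; rewrite ?inE.
have nuS : sigma_finite setT nu.
  by apply: fin_num_fun_sigma_finite => //; rewrite measure0.
(* [nu] is a bare measure; its finiteness is packaged as a sigma-finite structure so that Tonelli's
   theorem applies to it. *)
pose H1 := isSFinite.Build _ _ _ (nu : set R -> \bar R)
  (sfinite_measure_sigma_finite nuS).
pose H2 := isSigmaFinite.Build _ _ _ (nu : set R -> \bar R) nuS.
pose nu' := HB.pack_for (SigmaFiniteMeasure.type R R) (Measure.sort nu) H1 H2.
exact: (@measurable_fun_fubini_tonelli_F _ _ T _ R nu' g mg g0).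
Qed.

(** * Iterated integrals over the responses *)

Lemma pdens_gt0 (R : realType) d (nu : {measure set R -> \bar R})
  (theta : 'rV[R]_d) x y : 0 < pdens nu theta x y.
Proof. exact: expR_gt0. Qed.

Lemma pdens_ge0 (R : realType) d (nu : {measure set R -> \bar R})
  (theta : 'rV[R]_d) x y : 0 <= pdens nu theta x y.
Proof. exact: expR_ge0. Qed.

Lemma measurable_pdens (R : realType) d (nu : {measure set R -> \bar R})
  (theta : 'rV[R]_d) x : measurable_fun setT (pdens nu theta x).
Proof.
apply: (measurableT_comp (@measurable_expR R)).
by apply: measurable_funB => //; exact: measurable_funM.
Qed.

Lemma le_int_resp (R : realType) d (nu : {measure set R -> \bar R})
    (theta : 'rV[R]_d) n (xs : n.-tuple (Xd d)) (g1 g2 : n.-tuple R -> \bar R) :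
  (forall t, g1 t <= g2 t)%E ->
  (int_resp nu theta xs g1 <= int_resp nu theta xs g2)%E.
Proof.
elim: n xs g1 g2 => [|n IH] xs g1 g2 g12 /=; first exact: g12.
apply: le_integralT => y; rewrite lee_pmul2l ?lte_fin ?pdens_gt0//.
by apply: IH => t.
Qed.

Lemma int_resp_ge0 (R : realType) d (nu : {measure set R -> \bar R})
    (theta : 'rV[R]_d) n (xs : n.-tuple (Xd d)) (g : n.-tuple R -> \bar R) :
  (forall t, 0 <= g t)%E -> (0 <= int_resp nu theta xs g)%E.
Proof.
elim: n xs g => [|n IH] xs g g0 /=; first exact: g0.
apply: integral_ge0 => y _; rewrite mule_ge0 ?lee_fin ?pdens_ge0//.
by apply: IH => t; exact: g0.
Qed.

(** The parameter space [T] is arbitrary so that the induction can absorb the first response into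
    it: the inner integral is treated over [T * R]. *)
Lemma measurable_int_resp dT (T : measurableType dT) (R : realType) d
    (nu : {measure set R -> \bar R}) (theta : 'rV[R]_d) n
    (xs : n.-tuple (Xd d)) (g : T * n.-tuple R -> \bar R) :
  (nu setT < +oo)%E -> measurable_fun setT g -> (forall z, 0 <= g z)%E ->
  measurable_fun setT (fun t => int_resp nu theta xs (fun ys => g (t, ys))).
Proof.
move=> nufin; elim: n dT T xs g => [|n IH] dT T xs g mg g0 /=.
  by apply: (measurableT_comp mg); apply: measurable_fun_pair.
apply: (@measurable_integral_snd _ T R nu (fun z : T * R =>
  ((pdens nu theta (thead xs) z.2)%:E * int_resp nu theta (behead_tuple xs)
    (fun t => g (z.1, cons_tuple z.2 t)))%E)) => //.
- apply: emeasurable_funM.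
    apply/measurable_EFinP; apply: measurableT_comp => //.
    exact: measurable_pdens.
  apply: (IH _ (T * R)%type (behead_tuple xs)
    (fun z => g (z.1.1, cons_tuple z.1.2 z.2))) => [|z]; last exact: g0.
  apply: (measurableT_comp mg); apply: measurable_fun_pair.
    exact: measurableT_comp.
  by apply: measurable_cons => //; exact: measurableT_comp.
- move=> z; rewrite mule_ge0 ?lee_fin ?pdens_ge0//.
  by apply: int_resp_ge0 => t.
Qed.

(* The weights are squares [b j ^+ 2] so that one integration step multiplies
   [b j] by the square root of a density and keeps the shape of the bound. *)
Lemma int_resp_affinity (R : realType) d (nu : {measure set R -> \bar R})
    (J K : finType) (nb : K -> J -> J) (theta : J -> 'rV[R]_d) (r k l : R) n
    (xs : n.-tuple (Xd d)) (g : J -> n.-tuple R -> \bar R) :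
  (nu setT < +oo)%E -> 0 <= r -> 0 <= k -> 0 <= l ->
  (forall j x, \int[nu]_y (pdens nu (theta j) x y)%:E = 1)%E ->
  (forall i j x, r%:E <= \int[nu]_y (Num.sqrt (pdens nu (theta j) x y) *
     Num.sqrt (pdens nu (theta (nb i j)) x y))%:E)%E ->
  (forall j, measurable_fun setT (g j)) -> (forall j t, 0 <= g j t)%E ->
  (forall b : J -> R, (forall j, 0 <= b j)%R -> forall t,
     (l * \sum_(p : K * J) b p.2 * b (nb p.1 p.2))%:E <=
     \sum_j (b j ^+ 2)%:E * (g j t + k%:E))%E ->
  forall b : J -> R, (forall j, 0 <= b j) ->
     ((l * r ^+ n * \sum_(p : K * J) b p.2 * b (nb p.1 p.2))%:E <=
     \sum_j (b j ^+ 2)%:E * (int_resp nu (theta j) xs (g j) + k%:E))%E.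
Proof.
move=> nufin r0 k0 l0 p1 aff.
elim: n xs g => [|n IH] xs g mg g0 gl b b0.
  by rewrite expr0 mulr1 /=; exact: gl.
pose s j y := Num.sqrt (pdens nu (theta j) (thead xs) y).
have s0 j y : 0 <= s j y by exact: sqrtr_ge0.
have ms j : measurable_fun setT (s j).
  apply: (measurableT_comp (@measurable_sqrt R)); exact: measurable_pdens.
have sE j y : s j y ^+ 2 = pdens nu (theta j) (thead xs) y.
  by rewrite sqr_sqrtr// pdens_ge0.
have affs i j : (r%:E <= \int[nu]_y (s j y * s (nb i j) y)%:E)%E by exact: aff.
clearbody s.
pose I' j y := int_resp nu (theta j) (behead_tuple xs)
  (fun t => g j (cons_tuple y t)).
have I'0 j y : (0 <= I' j y)%E by apply: int_resp_ge0 => t; exact: g0.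
have mI' j : measurable_fun setT (I' j).
  apply: (@measurable_int_resp _ R R d nu (theta j) n (behead_tuple xs)
    (fun z => g j (cons_tuple z.1 z.2))) => //.
  by apply: (measurableT_comp (mg j)); apply: measurable_cons.
(* Since the density integrates to 1, the constant [k] can be moved under the outermost integral. *)
have step j : ((b j ^+ 2)%:E * (int_resp nu (theta j) xs (g j) + k%:E) =
    \int[nu]_y (((b j * s j y) ^+ 2)%:E * (I' j y + k%:E)))%E.
  have mp : measurable_fun setT
      (fun y => (pdens nu (theta j) (thead xs) y)%:E).
    by apply/measurable_EFinP; apply: measurable_pdens.
  have kE : (k%:E = \int[nu]_y ((pdens nu (theta j) (thead xs) y)%:E * k%:E))%E.
    rewrite ge0_integralZr//; first by rewrite p1 mul1e.
    by move=> y _; rewrite lee_fin pdens_ge0.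
  have mpI : measurable_fun setT
      (fun y => ((pdens nu (theta j) (thead xs) y)%:E * I' j y)%E).
    exact: emeasurable_funM.
  have mpk : measurable_fun setT
      (fun y => ((pdens nu (theta j) (thead xs) y)%:E * k%:E)%E).
    exact: emeasurable_funM.
  have pI0 y : (0 <= (pdens nu (theta j) (thead xs) y)%:E * I' j y)%E.
    by rewrite mule_ge0// lee_fin pdens_ge0.
  have pk0 y : (0 <= (pdens nu (theta j) (thead xs) y)%:E * k%:E)%E.
    by rewrite mule_ge0// lee_fin pdens_ge0.
  rewrite [in LHS]kE /= -ge0_integralD// -ge0_integralZl//.
  - apply: eq_integral => y _; rewrite exprMn sE.
    rewrite [in RHS](EFinM (b j ^+ 2)) -[in RHS]muleA; congr (_ * _)%E.
    by rewrite -ge0_muleDr ?lee_fin//; exact: I'0.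
  - exact: emeasurable_funD.
  - by move=> y _; exact: adde_ge0.
  - by rewrite lee_fin sqr_ge0.
rewrite (eq_bigr _ (fun j _ => step j)).
rewrite -ge0_integral_sum//; last 2 first.
- move=> j; apply: emeasurable_funM.
    apply/measurable_EFinP/measurable_funX.
    by apply: measurable_funM => //; exact: measurable_cst.
  by apply: emeasurable_funD => //; exact: measurable_cst.
- move=> j y _; apply: mule_ge0; first by rewrite lee_fin sqr_ge0.
  by apply: adde_ge0 => //; rewrite lee_fin.
pose low y := (\sum_(p : K * J) ((l * r ^+ n * (b p.2 * b (nb p.1 p.2)))%:E *
    (s p.2 y * s (nb p.1 p.2) y)%:E))%E.
have lowE y : low y = (l * r ^+ n * \sum_(p : K * J) (b p.2 * s p.2 y) *
       (b (nb p.1 p.2) * s (nb p.1 p.2) y))%:E.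
  rewrite mulr_sumr -sumEFin; apply: eq_bigr => p _.
  by rewrite -EFinM -(mulrA (l * r ^+ n)) (mulrACA (b p.2) (b _)).
have low_le y : (low y <= \sum_j ((b j * s j y) ^+ 2)%:E * (I' j y + k%:E))%E.
  rewrite lowE.
  have bs0 j : 0 <= b j * s j y by rewrite mulr_ge0.
  apply: (IH (behead_tuple xs) (fun j t => g j (cons_tuple y t)) _ _ _
    (fun j => b j * s j y) bs0) => [j|j t|c c0 t].
  - by apply: (measurableT_comp (mg j)); apply: measurable_cons.
  - exact: g0.
  - exact: gl.
apply: (@le_trans _ _ (\int[nu]_y low y)%E); last first.
  by apply: le_integralT => y; exact: low_le.
have c0 p : 0 <= l * r ^+ n * (b p.2 * b (nb p.1 p.2)).
  by rewrite !mulr_ge0 ?exprn_ge0.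
have mss (p : K * J) :
    measurable_fun setT (fun y => (s p.2 y * s (nb p.1 p.2) y)%:E).
  by apply/measurable_EFinP; apply: measurable_funM.
rewrite ge0_integral_sum//; last 2 first.
- move=> p; apply: emeasurable_funM; [exact: measurable_cst|exact: mss].
- by move=> p y _; apply: mule_ge0; rewrite lee_fin// mulr_ge0.
(* Each product of weights now multiplies the integral of a product of root densities, an affinity
   of at least [r]: this is the new factor of the power of [r]. *)
rewrite mulr_sumr -sumEFin; apply: lee_sum => p _.
rewrite ge0_integralZl//; last 2 first.
- by move=> y _; rewrite lee_fin mulr_ge0.
- by rewrite lee_fin.
rewrite exprSr (mulrA l) mulrAC EFinM.
by apply: lee_pmul; rewrite ?lee_fin//; exact: affs.
Qed.

(** * The cube {-1,1}^d *)

Definition flip d (i : 'I_d) (x : Xd d) : Xd d :=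
  [ffun j => if j == i then ~~ x j else x j].

Lemma flipK d (i : 'I_d) : involutive (flip i).
Proof.
by move=> x; apply/ffunP => j; rewrite !ffunE; case: eqP => // _; rewrite negbK.
Qed.

Lemma sum_flip (V : nmodType) d (i : 'I_d) (F : Xd d -> V) :
  \sum_x F (flip i x) = \sum_x F x.
Proof. by rewrite [RHS](reindex_inj (can_inj (flipK i))). Qed.

Lemma xcoord_flip (R : realType) d (i j : 'I_d) (x : Xd d) :
  xcoord R (flip i x) j = if j == i then - xcoord R x j else xcoord R x j.
Proof.
by rewrite /xcoord ffunE; case: eqP => // _; case: (x j); rewrite ?opprK.
Qed.

Lemma xcoord_sqr (R : realType) d (x : Xd d) i : xcoord R x i ^+ 2 = 1.
Proof. by rewrite /xcoord; case: (x i); rewrite ?sqrrN expr1n. Qed.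

Lemma normr_xcoord (R : realType) d (x : Xd d) i : `|xcoord R x i| = 1.
Proof. by rewrite /xcoord; case: (x i); rewrite ?normrN normr1. Qed.

Lemma card_Xd_gt0 (R : realType) d : 0 < #|{: Xd d}|%:R :> R.
Proof. by rewrite ltr0n card_ffun card_bool expn_gt0. Qed.

Lemma sum_xcoordM (R : realType) d (i j : 'I_d) :
  \sum_(x : Xd d) xcoord R x i * xcoord R x j = #|{: Xd d}|%:R * (i == j)%:R.
Proof.
have [<-|ij] := eqVneq i j.
  under eq_bigr do rewrite -expr2 xcoord_sqr.
  by rewrite sumr_const mulr1.
rewrite mulr0; set S := LHS.
(* Flipping coordinate [i] permutes the cube and negates every summand. *)
have : S = - S.
  rewrite {1}/S -(sum_flip i) -sumrN; apply: eq_bigr => x _.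
  by rewrite !xcoord_flip eqxx eq_sym (negbTE ij) mulNr.
lra.
Qed.

Section cube_average.
Variables (R : realType) (d : nat).
Let N : R := #|{: Xd d}|%:R.

(** The degree-one Walsh-Fourier coefficient of [w] under the uniform law on the cube. *)
Definition cube_coef (w : Xd d -> R) (i : 'I_d) : R :=
  N^-1 * \sum_x xcoord R x i * w x.

(** Orthonormality of the coordinates. Root densities are nearly linear in [dotx], so this is how
    the i-th entry of the parameter is read off. *)
Lemma cube_coef_lin (a : R) (v : 'rV[R]_d) i :
  cube_coef (fun x => a * dotx v x) i = a * v 0 i.
Proof.
rewrite /cube_coef /dotx.
under eq_bigr do rewrite mulrCA mulr_sumr.
rewrite -mulr_sumr exchange_big /= (bigD1 i) //= [X in _ + X]big1 ?addr0 => [|j ji].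
- under eq_bigr do rewrite mulrCA.
  rewrite -mulr_sumr sum_xcoordM eqxx mulr1 -/N.
  have N0 : N != 0 by rewrite gt_eqF// card_Xd_gt0.
  by field.
- under eq_bigr do rewrite mulrCA.
  by rewrite -mulr_sumr sum_xcoordM eq_sym (negbTE ji) !mulr0.
Qed.

(** [k] is the orthogonal projection of [w] on the span of the coordinates, so its inner product
    with [w] equals its squared norm. The form 2kw - k^2 is linear in [w], hence suited to a
    pointwise lower bound under an integral. *)
Lemma cube_bessel (w : Xd d -> R)
    (k := fun x : Xd d => \sum_i cube_coef w i * xcoord R x i) :
  N^-1 * \sum_x (2 * k x * w x - k x ^+ 2) = \sum_i cube_coef w i ^+ 2.
Proof.
have N0 : N != 0 by rewrite gt_eqF// card_Xd_gt0.
have kw : \sum_x k x * w x = N * \sum_i cube_coef w i ^+ 2.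
  under eq_bigr do rewrite /k mulr_suml.
  rewrite exchange_big mulr_sumr /=; apply: eq_bigr => i _.
  under eq_bigr do rewrite -mulrA.
  by rewrite -mulr_sumr {2}/cube_coef expr2; rewrite /cube_coef; field.
have kk : \sum_x k x ^+ 2 = N * \sum_i cube_coef w i ^+ 2.
  transitivity (\sum_x \sum_i \sum_j cube_coef w i * cube_coef w j *
      (xcoord R x i * xcoord R x j)).
    apply: eq_bigr => x _; rewrite expr2 /k mulr_suml; apply: eq_bigr => i _.
    by rewrite mulr_sumr; apply: eq_bigr => j _; rewrite mulrACA.
  rewrite exchange_big mulr_sumr /=; apply: eq_bigr => i _.
  rewrite exchange_big /= (bigD1 i)//= [X in _ + X]big1 ?addr0 => [|j ji].
    by rewrite -mulr_sumr sum_xcoordM eqxx mulr1 mulrC -expr2.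
  by rewrite -mulr_sumr sum_xcoordM eq_sym (negbTE ji) !mulr0.
under eq_bigr do rewrite -mulrA.
by rewrite sumrB -mulr_sumr kw kk; field.
Qed.

End cube_average.

(** * Lower bound on the excess risk *)

(** By AM-GM the product is dominated by f + e^2. *)
Lemma integrable_sqrtM d (T : measurableType d) (R : realType)
    (mu : {measure set T -> \bar R}) (f e : T -> R) :
  (forall y, 0 <= f y) -> measurable_fun setT e ->
  mu.-integrable setT (EFin \o f) ->
  mu.-integrable setT (EFin \o (fun y => e y ^+ 2)) ->
  mu.-integrable setT (EFin \o (fun y => Num.sqrt (f y) * e y)).
Proof.
move=> f0 me fi ei.
apply: (le_integrable _ _ _ (integrableD _ fi ei)) => //.
- apply/measurable_EFinP; apply: measurable_funM => //.
  apply: (measurableT_comp (@measurable_sqrt R)).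
  by apply/measurable_EFinP; exact: measurable_int fi.
- move=> y _ /=; rewrite lee_fin [leRHS]ger0_norm ?addr_ge0 ?sqr_ge0//.
  rewrite normrM (ger0_norm (sqrtr_ge0 _)) -{2}(sqr_sqrtr (f0 y)).
  rewrite -[e y ^+ 2]real_normK ?num_real//.
  set a := Num.sqrt _; set b := `|_|.
  have a0 : 0 <= a := sqrtr_ge0 _; have b0 : 0 <= b := normr_ge0 _.
  nra.
Qed.

(** From ln t <= t - 1 at t = sqrt (q / p), p (ln p - ln q) is at least (p - q) + (sqrt p - sqrt
    q)^2; the square z^2 is then bounded below by 2zw - w^2 with [w] free. For q = 0 the right side
    is infinite. *)
Lemma kl_integrand_ge (R : realType) (p q w : R) : 0 < p -> 0 <= q ->
  ((- (p * ln p) + (p - q) + 2 * ((Num.sqrt p - Num.sqrt q) * w) - w ^+ 2)%:E <=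
   p%:E * - lne q%:E)%E.
Proof.
move=> p0; rewrite le_eqVlt => /predU1P[<-|q0].
  by rewrite /= lexx gt0_muley ?leey// lte_fin.
rewrite lne_EFin// -EFinN -EFinM lee_fin.
have a0 : 0 < Num.sqrt p by rewrite sqrtr_gt0.
have s0 : 0 < Num.sqrt q by rewrite sqrtr_gt0.
have pE := sqr_sqrtr (ltW p0); have qE := sqr_sqrtr (ltW q0).
have -> : ln p = ln (Num.sqrt p) *+ 2 by rewrite -lnXn// pE.
have -> : ln q = ln (Num.sqrt q) *+ 2 by rewrite -lnXn// qE.
move: (Num.sqrt p) (Num.sqrt q) a0 s0 pE qE => a s a0 s0 pE qE.
have : ln s - ln a <= s / a - 1.
  rewrite -ln_div ?posrE//; have := @le_ln1Dx R (s / a - 1).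
  rewrite addrCA subrr addr0; apply.
  by rewrite ltrBDr addNr divr_gt0.
move: (ln s) (ln a) => ls la h.
have h2 : p * (ls - la) <= a * s - p.
  have -> : a * s - p = p * (s / a - 1) by rewrite -pE; field; rewrite gt_eqF.
  by apply: ler_wpM2l => //; exact: ltW.
have := sqr_ge0 (a - s - w); rewrite !mulr2n; nra.
Qed.

Lemma integrable_ge0_fin d (T : measurableType d) (R : realType)
    (mu : {measure set T -> \bar R}) (f : T -> R) :
  measurable_fun setT f -> (forall y, 0 <= f y) ->
  (\int[mu]_y (f y)%:E < +oo)%E -> mu.-integrable setT (EFin \o f).
Proof.
move=> mf f0 fi; apply/integrableP; split; first exact/measurable_EFinP.
by under eq_integral do rewrite /= ger0_norm//.
Qed.

Section excess_risk.
Variables (R : realType) (d : nat) (nu : {measure set R -> \bar R}).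

Definition hell_proj (e : R -> R) (q : Xd d -> R -> R) (x : Xd d) : R :=
  \int[nu]_y (Num.sqrt (q x y) * e y).

Lemma pred_density_integrable (q : Xd d -> R -> R) x :
  pred_density nu q -> nu.-integrable setT (EFin \o q x).
Proof.
move=> /(_ x)[q0 mq q1]; apply: integrable_ge0_fin => //.
by rewrite q1 ltry.
Qed.

(* Bessel's inequality in [L2(Uniform * nu)] for the orthonormal system
   [xcoord x i * e y], applied to the Hellinger lower bound
   [KL(p, q) >= int (sqrt p - sqrt q)^2]. *)
Lemma excess_risk_ge (theta : 'rV[R]_d) (q : Xd d -> R -> R) (e : R -> R) :
  pred_density nu (pdens nu theta) -> pred_density nu q ->
  (forall x, nu.-integrable setT
     (EFin \o (fun y => pdens nu theta x y * ln (pdens nu theta x y)))) ->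
  measurable_fun setT e ->
  nu.-integrable setT (EFin \o (fun y => e y ^+ 2)) ->
  \int[nu]_y (e y ^+ 2) = 1 ->
  ((\sum_i (cube_coef (hell_proj e (pdens nu theta)) i -
            cube_coef (hell_proj e q) i) ^+ 2)%:E <=
   risk nu theta q - risk_star nu theta)%E.
Proof.
move=> dp dq pln me ie e1.
pose p := pdens nu theta; pose N : R := #|{: Xd d}|%:R.
pose w x := hell_proj e p x - hell_proj e q x.
pose k x := \sum_i cube_coef w i * xcoord R x i.
pose H x := - \int[nu]_y (p x y * ln (p x y)).
have wE i :
    cube_coef w i = cube_coef (hell_proj e p) i - cube_coef (hell_proj e q) i.
  rewrite /cube_coef -mulrBr -sumrB; congr (_ * _); apply: eq_bigr => x _.
  by rewrite mulrBr.
have riskp : risk nu theta p = (N^-1 * \sum_x H x)%:E.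
  rewrite /risk /Ejoint EFinM -sumEFin; congr (_ * _)%E; apply: eq_bigr => x _.
  transitivity (\int[nu]_y (- (p x y * ln (p x y)))%:E)%E.
    apply: eq_integral => y _.
    by rewrite lne_EFin ?pdens_gt0// -EFinN -EFinM mulrN.
  have h : nu.-integrable setT (EFin \o (fun y => - (p x y * ln (p x y)))).
    exact: (integrableN (pln x)).
  rewrite -[LHS]fineK; last exact: integrable_fin_num h.
  congr EFin; rewrite -/(Rintegral _ _ _) /H -mulN1r -RintegralZl//.
  by apply: eq_Rintegral => y _; rewrite mulN1r.
have riskq : ((N^-1 * \sum_x (H x + (2 * k x * w x - k x ^+ 2)))%:E <=
    risk nu theta q)%E.
  rewrite /risk /Ejoint EFinM -sumEFin; apply: lee_wpmul2l.
    by rewrite lee_fin invr_ge0 ltW// card_Xd_gt0.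
  apply: lee_sum => x _.
  have ip := pred_density_integrable x dp.
  have iq := pred_density_integrable x dq.
  have [p0 mp p1] := dp x; have [q0 mq q1] := dq x.
  have isp := integrable_sqrtM p0 me ip ie.
  have isq := integrable_sqrtM q0 me iq ie.
  pose h1 y := -1 * (p x y * ln (p x y)).
  pose h2 y := p x y - q x y.
  pose h3 y := (2 * k x) * (Num.sqrt (p x y) * e y - Num.sqrt (q x y) * e y).
  pose h4 y := (k x ^+ 2) * e y ^+ 2.
  have i1 : nu.-integrable setT (EFin \o h1).
    exact: (integrableZl _ (-1) (pln x)).
  have i2 : nu.-integrable setT (EFin \o h2) by exact: (integrableB _ ip iq).
  have i3' : nu.-integrable setT (EFin \o (fun y =>
      Num.sqrt (p x y) * e y - Num.sqrt (q x y) * e y)).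
    exact: (integrableB _ isp isq).
  have i3 : nu.-integrable setT (EFin \o h3).
    exact: (integrableZl _ (2 * k x) i3').
  have i4 : nu.-integrable setT (EFin \o h4).
    exact: (integrableZl _ (k x ^+ 2) ie).
  have i12 : nu.-integrable setT (EFin \o (fun y => h1 y + h2 y)).
    exact: (integrableD _ i1 i2).
  have i123 : nu.-integrable setT (EFin \o (fun y => h1 y + h2 y + h3 y)).
    exact: (integrableD _ i12 i3).
  have i1234 : nu.-integrable setT
      (EFin \o (fun y => h1 y + h2 y + h3 y - h4 y)).
    exact: (integrableB _ i123 i4).
  have hE : H x + (2 * k x * w x - k x ^+ 2) =
      \int[nu]_y (h1 y + h2 y + h3 y - h4 y).
    rewrite RintegralB// RintegralD// RintegralD//.
    rewrite RintegralZl// RintegralB// RintegralZl// RintegralB// RintegralZl//.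
    rewrite e1 {2 3}/Rintegral p1 q1 /= /H /w /hell_proj; ring.
  rewrite hE fineK; last exact: integrable_fin_num i1234.
  apply: le_integralT => y.
  (* The free function is [k x * e y]: after integration p - q vanishes, the cross term gives 2kw
     and, [e] having unit norm, the square gives k^2. *)
  apply: le_trans (kl_integrand_ge (k x * e y) (pdens_gt0 nu theta x y) (q0 y)).
  rewrite lee_fin le_eqVlt; apply/orP; left; apply/eqP.
  by rewrite /h1 /h2 /h3 /h4 /p; ring.
(* The true density competes in the infimum, so replacing [risk_star] by its risk can only lower the
   excess. *)
have risks : (risk_star nu theta <= risk nu theta p)%E.
  by apply: ereal_inf_lbound; exists p.
apply: (@le_trans _ _ (risk nu theta q - risk nu theta p))%E; last first.
  by apply: leeB.
rewrite riskp leeBrDr//; apply: le_trans riskq.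
rewrite -EFinD lee_fin big_split mulrDr [leRHS]addrC lerD2r.
rewrite (cube_bessel w) le_eqVlt; apply/orP; left; apply/eqP.
by apply: eq_bigr => i _; rewrite wE.
Qed.

End excess_risk.

Lemma measurable_Rintegral_snd d (T : measurableType d) (R : realType)
    (nu : {measure set R -> \bar R}) (h : T * R -> R) :
  (nu setT < +oo)%E -> measurable_fun setT h ->
  measurable_fun setT (fun t => \int[nu]_y h (t, y)).
Proof.
move=> nufin mh.
have mE : measurable_fun setT (EFin \o h) by exact/measurable_EFinP.
apply: (measurableT_comp (@fine_measurable R setT measurableT)).
have -> : (fun t => \int[nu]_y (h (t, y))%:E)%E =
    (fun t => \int[nu]_y (EFin \o h)^\+ (t, y) -
              \int[nu]_y (EFin \o h)^\- (t, y))%E.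
  apply/funext => t; rewrite integralE.
  by congr (_ - _)%E; apply: eq_integral => y _; rewrite ?funeposE ?funenegE.
apply: emeasurable_funB.
- by apply: measurable_integral_snd => //; exact: measurable_funepos.
- by apply: measurable_integral_snd => //; exact: measurable_funeneg.
Qed.

(** * Two-point bounds and Assouad's lemma *)

(** AM-GM on the pairs (P|u|, Q s D) and (Q|v|, P s D), then |u| + |v| >= D. The additive slack (s
    D)^2 is the price for a lower bound in the product PQ, which integrates to an affinity when P
    and Q are root likelihoods. *)
Lemma two_point_bound (R : realType) (s D P Q u v : R) :
  0 <= s -> 0 <= D -> 0 <= P -> 0 <= Q -> D <= `|u - v| ->
  2 * (s * D ^+ 2 * (P * Q)) <=
  P ^+ 2 * (u ^+ 2 + (s * D) ^+ 2) + Q ^+ 2 * (v ^+ 2 + (s * D) ^+ 2).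
Proof.
move=> s0 D0 P0 Q0 /le_trans /(_ (ler_normB u v)).
rewrite -[u ^+ 2]real_normK ?num_real// -[v ^+ 2]real_normK ?num_real//.
move: `|u| `|v| => a b Dab.
have : s * D * (P * Q) * D <= s * D * (P * Q) * (a + b).
  by apply: ler_wpM2l => //; rewrite !mulr_ge0.
have := sqr_ge0 (P * a - Q * (s * D)); have := sqr_ge0 (Q * b - P * (s * D)).
nra.
Qed.

(** For each coordinate [i], vertex [t] is paired with [flip i t]; summing over all [t] counts each
    pair twice, which matches the factor 2 of the two-point bound. The slacks of the [d] coordinates
    add up. *)
Lemma cube_pairing_bound (R : realType) d (phi : Xd d -> 'I_d -> R)
    (a : 'I_d -> R) (s D : R) (b : Xd d -> R) :
  0 <= s -> 0 <= D -> (forall t, 0 <= b t) ->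
  (forall t i, D <= `|phi t i - phi (flip i t) i|) ->
  s * D ^+ 2 * \sum_(p : 'I_d * Xd d) b p.2 * b (flip p.1 p.2) <=
  \sum_t b t ^+ 2 * (\sum_i (phi t i - a i) ^+ 2 + d%:R * (s * D) ^+ 2).
Proof.
move=> s0 D0 b0 phiD.
have -> : \sum_t b t ^+ 2 * (\sum_i (phi t i - a i) ^+ 2 + d%:R * (s * D) ^+ 2) =
    \sum_i \sum_t b t ^+ 2 * ((phi t i - a i) ^+ 2 + (s * D) ^+ 2).
  rewrite exchange_big; apply: eq_bigr => t _ /=.
  rewrite -mulr_sumr big_split /= sumr_const card_ord.
  by rewrite mulr_natl.
rewrite -(pair_bigA _ (fun i t => b t * b (flip i t))) /= mulr_sumr.
apply: ler_sum => i _; rewrite -(@ler_pM2l _ 2)//.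
have -> : 2 * (\sum_t b t ^+ 2 * ((phi t i - a i) ^+ 2 + (s * D) ^+ 2)) =
    \sum_t (b t ^+ 2 * ((phi t i - a i) ^+ 2 + (s * D) ^+ 2) +
     b (flip i t) ^+ 2 * ((phi (flip i t) i - a i) ^+ 2 + (s * D) ^+ 2)).
  rewrite big_split /= (sum_flip i (fun t => b t ^+ 2 *
    ((phi t i - a i) ^+ 2 + (s * D) ^+ 2))); ring.
rewrite !mulr_sumr; apply: ler_sum => t _; apply: two_point_bound => //.
by have := phiD t i; congr (_ <= `|_|); ring.
Qed.

(** Assouad's lemma: the supremum dominates the average over the vertices, and for each fixed
    covariate sample that average is bounded by the pairing bound carried through the n responses
    with unit weights. *)
Lemma minimax_excess_risk_ge (R : realType) d (nu : {measure set R -> \bar R})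
    (Theta : set 'rV[R]_d) n (theta : Xd d -> 'rV[R]_d) (e : R -> R) (D r : R) :
  (nu setT < +oo)%E -> (forall t, Theta (theta t)) ->
  (forall t, pred_density nu (pdens nu (theta t))) ->
  (forall t x, nu.-integrable setT (EFin \o
     (fun y => pdens nu (theta t) x y * ln (pdens nu (theta t) x y)))) ->
  measurable_fun setT e ->
  nu.-integrable setT (EFin \o (fun y => e y ^+ 2)) ->
  \int[nu]_y (e y ^+ 2) = 1 ->
  0 <= D ->
  (forall t i, D <= `|cube_coef (hell_proj nu e (pdens nu (theta t))) i -
                 cube_coef (hell_proj nu e (pdens nu (theta (flip i t)))) i|) ->
  0 <= r -> 2^-1 <= r ^+ n ->
  (forall i t x, r%:E <= \int[nu]_y (Num.sqrt (pdens nu (theta t) x y) *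
     Num.sqrt (pdens nu (theta (flip i t)) x y))%:E)%E ->
  ((d%:R * D ^+ 2 / 16)%:E <= minimax_excess_risk nu Theta n)%E.
Proof.
move=> nufin thetaT dp pln me ie e1 D0 phiD r0 rn aff.
apply: le_ereal_inf_tmp => _ [est [estd estm] <-].
set S := ereal_sup _.
pose N : R := #|{: Xd d}|%:R; have N0 : 0 < N by exact: card_Xd_gt0.
pose M : R := #|{: n.-tuple (Xd d)}|%:R.
have M0 : 0 < M.
  by rewrite ltr0n card_tuple expn_gt0 card_ffun card_bool expn_gt0.
pose phi t i := cube_coef (hell_proj nu e (pdens nu (theta t))) i.
pose a xs ys i := cube_coef (hell_proj nu e (est xs ys)) i.
pose g xs t ys := (\sum_i (phi t i - a xs ys i) ^+ 2)%:E.
have g0 xs t ys : (0 <= g xs t ys)%E.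
  by rewrite lee_fin sumr_ge0// => i _; exact: sqr_ge0.
have ma xs i : measurable_fun setT (fun ys => a xs ys i).
  apply: measurable_funM; first exact: measurable_cst.
  apply: measurable_sum => x; apply: measurable_funM; first exact: measurable_cst.
  apply: (@measurable_Rintegral_snd _ _ R nu
    (fun z => Num.sqrt (est xs z.1 x z.2) * e z.2)) => //.
  apply: measurable_funM; last exact: measurableT_comp.
  exact: (measurableT_comp (@measurable_sqrt R) (estm xs x)).
have mg xs t : measurable_fun setT (g xs t).
  apply/measurable_EFinP; apply: measurable_sum => i; apply: measurable_funX.
  by apply: measurable_funB => //; exact: measurable_cst.
have sumI xs : ((N * (d%:R * D ^+ 2 / 16))%:E <=
    \sum_t int_resp nu (theta t) xs (g xs t))%E.
  (* The pairing bound is used with s = 1/4, the maximiser of s/2 - s^2: since r^n >= 1/2, each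
     coordinate and vertex gains D^2/8 and pays the slack D^2/16. *)
  pose k : R := d%:R * (4^-1 * D) ^+ 2.
  have k0 : 0 <= k by rewrite mulr_ge0 ?ler0n ?sqr_ge0.
  have sum1 : \sum_(p : 'I_d * Xd d) (1 * 1 : R) = d%:R * N.
    by rewrite mulr1 sumr_const card_prod card_ord natrM.
  have sumk : (\sum_(t : Xd d) (1 ^+ 2)%:E *
      (int_resp nu (theta t) xs (g xs t) + k%:E) =
      \sum_t int_resp nu (theta t) xs (g xs t) + (N * k)%:E)%E.
    under eq_bigr do rewrite expr1n mul1e.
    rewrite big_split /=; congr (_ + _)%E.
    by rewrite sumEFin sumr_const -mulr_natl.
  have h : ((4^-1 * D ^+ 2 * r ^+ n * (d%:R * N))%:E <=
      \sum_t int_resp nu (theta t) xs (g xs t) + (N * k)%:E)%E.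
    rewrite -sumk -sum1.
    apply: (@int_resp_affinity R d nu (Xd d) 'I_d (@flip d) theta r k
      (4^-1 * D ^+ 2) n xs (g xs) nufin r0 k0) => //.
    - by rewrite mulr_ge0 ?sqr_ge0.
    - by move=> t x; have [] := dp t x.
    - move=> b b0 ys.
      have s0 : 0 <= 4^-1 :> R by [].
      have := cube_pairing_bound (a xs ys) s0 D0 b0 phiD.
      rewrite -lee_fin => /le_trans; apply.
      rewrite -sumEFin; apply: lee_sum => t _.
      by rewrite EFinM EFinD.
  rewrite -leeBlDr// in h; apply: le_trans h.
  rewrite -EFinB lee_fin /k.
  have dN : 0 <= D ^+ 2 * (d%:R * N) by rewrite !mulr_ge0 ?sqr_ge0 ?ler0n// ltW.
  have := ler_wpM2l dN rn; lra.
have EER t : ((M^-1)%:E * \sum_(xs : n.-tuple (Xd d))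
      int_resp nu (theta t) xs (g xs t) <= S)%E.
  apply: (@le_trans _ _ (expected_excess_risk nu (theta t) est)).
    apply: lee_wpmul2l; first by rewrite lee_fin invr_ge0 ltW.
    apply: lee_sum => xs _; apply: le_int_resp => ys.
    by apply: excess_risk_ge => //.
  by apply: ereal_sup_ubound; exists (theta t).
have I0 xs t : (0 <= int_resp nu (theta t) xs (g xs t))%E.
  by apply: int_resp_ge0 => ys.
(* This excludes the value -oo in the final case analysis on [S]. *)
have S0 : (0 <= S)%E.
  apply: le_trans (EER [ffun=> true]); apply: mule_ge0.
    by rewrite lee_fin invr_ge0 ltW.
  by apply: sume_ge0 => xs _.
have SN : ((N * (d%:R * D ^+ 2 / 16))%:E <= \sum_(t : Xd d) S)%E.
  apply: (@le_trans _ _ (\sum_(t : Xd d) ((M^-1)%:E *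
    \sum_(xs : n.-tuple (Xd d)) int_resp nu (theta t) xs (g xs t)))%E); last first.
    by apply: lee_sum => t _; exact: EER.
  rewrite -ge0_sume_distrr; last by move=> t _; exact: sume_ge0.
  rewrite exchange_big /=.
  apply: (@le_trans _ _ ((M^-1)%:E * \sum_(xs : n.-tuple (Xd d))
     (N * (d%:R * D ^+ 2 / 16))%:E)%E); last first.
    apply: lee_wpmul2l; first by rewrite lee_fin invr_ge0 ltW.
    by apply: lee_sum => xs _; exact: sumI.
  rewrite sumEFin sumr_const -EFinM lee_fin -[X in _ <= _ * X]mulr_natl mulKf//.
  by rewrite gt_eqF.
move: S0 SN; case: (S) => [s s0|_ _|//]; last exact: leey.
by rewrite sumEFin sumr_const !lee_fin -[X in _ <= X]mulr_natl ler_pM2l.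
Qed.

(** * Local expansion of the exponential family *)

(** The inequality 1 + x <= exp x at x and -x gives 0 <= exp x - 1 - x <= x (exp x - 1), and exp x -
    1 is compared with x once more. *)
Lemma expR_taylor1 (R : realType) (x : R) :
  `|expR x - 1 - x| <= x ^+ 2 * expR `|x|.
Proof.
have h1 := expR_ge1Dx x; have h2 := expR_ge1Dx (- x).
rewrite ger0_norm; last by lra.
have h3 : expR x - 1 <= x * expR x.
  have : expR x * (1 - x) <= expR x * expR (- x) by rewrite ler_pM2l ?expR_gt0.
  by rewrite expRxMexpNx_1; lra.
have [x0|x0] := leP 0 x.
- by rewrite ger0_norm//; nra.
- rewrite ltr0_norm//.
  have h4 : x ^+ 2 * 1 <= x ^+ 2 * expR (- x).
    by apply: ler_wpM2l; [exact: sqr_ge0|lra].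
  apply: le_trans h4; rewrite mulr1 expr2; nra.
Qed.

(** The derivative of this remainder is the first-order remainder, already bounded; the mean value
    theorem from 0 supplies the extra factor |x|. *)
Lemma expR_taylor2 (R : realType) (x : R) :
  `|expR x - 1 - x - x ^+ 2 / 2| <= `|x| ^+ 3 * expR `|x|.
Proof.
pose f : R -> R := fun t => expR t - 1 - t - t ^+ 2 / 2.
pose df : R -> R := fun t => expR t - 1 - t.
have fd (t : R) : is_derive t (1 : R) f (df t).
  rewrite /f /df; apply: is_derive_eq.
  by rewrite /GRing.scale /=; field.
have fc (A : set R) : {within A, continuous f}.
  apply: continuous_subspaceT => t.
  by apply/differentiable_continuous/derivable1_diffP; exact: ex_derive.
have f0 : f 0 = 0 by rewrite /f expR0 expr0n /=; lra.
have bnd c : `|c| <= `|x| -> `|df c| * `|x| <= `|x| ^+ 3 * expR `|x|.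
  move=> cx; rewrite exprSr -mulrA [`|x| * _]mulrC mulrA.
  apply: ler_wpM2r => //; apply: le_trans (expR_taylor1 c) _.
  apply: ler_pM; [exact: sqr_ge0|exact: expR_ge0| |by rewrite ler_expR].
  by rewrite -[c ^+ 2]real_normK ?num_real// lerXn2r// ?nnegrE.
have [x0|x0] := leP 0 x.
- have [c /[!in_itv]/= /andP[c0 cx]] := MVT_segment x0 (fun t _ => fd t) (fc _).
  rewrite f0 !subr0 => fE; rewrite -/(f x) fE normrM; apply: bnd.
  by rewrite !ger0_norm.
- have [c /[!in_itv]/= /andP[xc c0]] := MVT_segment (ltW x0) (fun t _ => fd t) (fc _).
  rewrite f0 !sub0r => /eqP; rewrite eqr_oppLR => /eqP fE.
  rewrite -/(f x) fE mulrN opprK normrM; apply: bnd.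
  by rewrite !ler0_norm ?lerN2// ltW.
Qed.

Lemma normrX_le_expR (R : realType) (c : R) k : 0 < c ->
  exists C : R, 0 <= C /\ forall z : R, `|z| ^+ k <= C * expR (c * `|z|).
Proof.
move=> c0; case: k => [|k].
  exists 1; split=> // z; rewrite expr0 mul1r -expR0 ler_expR.
  by rewrite mulr_ge0// ltW.
(* The constant comes from keeping a single term of the exponential series. *)
exists (k.+1`!%:R / c ^+ k.+1); split=> [|z].
  by rewrite divr_ge0// exprn_ge0// ltW.
have h := expR_ge1Dxn k (mulr_ge0 (ltW c0) (normr_ge0 z)).
have F0 : 0 < k.+1`!%:R :> R by rewrite ltr0n fact_gt0.
have c1 : 0 < c ^+ k.+1 by rewrite exprn_gt0.
rewrite mulrAC ler_pdivlMr// -exprMn [`|z| * c]mulrC [leRHS]mulrC -ler_pdivrMr//.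
by apply: le_trans h; rewrite lerDr.
Qed.

(** * Exponential moments of the base measure *)

Section exponential_moments.
Variables (R : realType) (nu : {measure set R -> \bar R}) (a : R).
Hypotheses (a0 : 0 < a) (Za : domA nu a) (ZNa : domA nu (- a)).

(** exp (a|y|) is at most exp (ay) + exp (-ay), integrable because both [a] and [- a] lie in [domA];
    the shift by [m] costs a constant factor. *)
Lemma integrable_expR_dom (m C : R) (f : R -> R) :
  measurable_fun setT f -> 0 <= C ->
  (forall y, `|f y| <= C * expR (a * `|y - m|)) ->
  nu.-integrable setT (EFin \o f).
Proof.
move=> mf C0 fC.
have mexp (u : R) : measurable_fun setT (fun y : R => expR (y * u)).
  by apply: (measurableT_comp (@measurable_expR R)); exact: measurable_funM.
have ia := integrable_ge0_fin (mexp a) (fun y => expR_ge0 (y * a)) Za.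
have iNa := integrable_ge0_fin (mexp (- a)) (fun y => expR_ge0 (y * - a)) ZNa.
apply: (le_integrable _ _ _ (integrableZl _ (C * expR (a * `|m|))
  (integrableD _ ia iNa))) => //; first exact/measurable_EFinP.
move=> y _ /=; rewrite lee_fin; apply: le_trans (fC y) _.
rewrite [leRHS]ger0_norm; last by rewrite mulr_ge0 ?addr_ge0 ?mulr_ge0 ?expR_ge0.
rewrite -mulrA; apply: ler_wpM2l => //.
apply: (@le_trans _ _ (expR (a * `|m|) * expR (a * `|y|))).
  rewrite -expRD ler_expR -mulrDr ler_pM2l// [leRHS]addrC; exact: ler_normB.
rewrite ler_pM2l ?expR_gt0//.
have [y0|y0] := leP 0 y.
- by rewrite ger0_norm// mulrC lerDl expR_ge0.
- by rewrite ltr0_norm// mulrN -mulNr mulrC lerDr expR_ge0.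
Qed.

Let a2 : 0 < a / 2. Proof. by rewrite divr_gt0. Qed.

(** Half of the available exponent [a] dominates exp (u (y - m)), the other half the power. *)
Lemma integrable_moment (m u : R) k : `|u| <= a / 2 ->
  nu.-integrable setT (EFin \o (fun y => (y - m) ^+ k * expR (u * (y - m)))).
Proof.
move=> ua; have [C [C0 hC]] := @normrX_le_expR R (a / 2) k a2.
apply: (@integrable_expR_dom m C) => //.
- apply: measurable_funM; first by apply: measurable_funX; exact: measurable_funB.
  apply: (measurableT_comp (@measurable_expR R)).
  by apply: measurable_funM => //; exact: measurable_funB.
- move=> y; rewrite normrM normrX (ger0_norm (expR_ge0 _)).
  rewrite [a in leRHS](splitr a) mulrDl expRD mulrA.
  apply: ler_pM => //.
  rewrite ler_expR; apply: le_trans (ler_norm _) _; rewrite normrM.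
  exact: ler_wpM2r.
Qed.

Lemma integrable_abs_moment (m : R) k :
  nu.-integrable setT
    (EFin \o (fun y => `|y - m| ^+ k * expR (a / 2 * `|y - m|))).
Proof.
have [C [C0 hC]] := @normrX_le_expR R (a / 2) k a2.
have mn : measurable_fun setT (fun y : R => `|y - m|).
  by apply: measurableT_comp => //; exact: measurable_funB.
apply: (@integrable_expR_dom m C) => //.
- apply: measurable_funM; first exact: measurable_funX.
  apply: (measurableT_comp (@measurable_expR R)).
  by apply: measurable_funM => //; exact: measurable_cst.
- move=> y; rewrite ger0_norm ?mulr_ge0 ?exprn_ge0 ?expR_ge0//.
  rewrite [a in leRHS](splitr a) mulrDl expRD mulrA.
  by apply: ler_wpM2r; [exact: expR_ge0|exact: hC].
Qed.

Lemma integrable_pow (m : R) k :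
  nu.-integrable setT (EFin \o (fun y => (y - m) ^+ k)).
Proof.
have := @integrable_moment m 0 k; rewrite normr0 => /(_ (ltW a2)).
apply: eq_integrable => // y _ /=.
by rewrite mul0r expR0 mulr1.
Qed.

Lemma fin_measure : (nu setT < +oo)%E.
Proof.
have /integrableP[_] := integrable_pow 0 0.
by under eq_integral do rewrite /= expr0 normr1; rewrite integral_cst// mul1e.
Qed.

(** The moment generating function centred at [m], left unnormalised; centring at the mean removes
    the first-order term of its expansion. *)
Definition cmgf (m u : R) : R := \int[nu]_y expR (u * (y - m)).

Lemma integrable_cmgf (m u : R) : `|u| <= a / 2 ->
  nu.-integrable setT (EFin \o (fun y => expR (u * (y - m)))).
Proof.
move=> /(integrable_moment m 0); apply: eq_integrable => // y _ /=.
by rewrite mul1r.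
Qed.

(** The pointwise expansion is integrated; |u| <= a/2 makes the constant of the cubic remainder
    independent of [u]. *)
Lemma cmgf_taylor (m u : R) : `|u| <= a / 2 ->
  `|cmgf m u - (\int[nu]_y 1 + u * \int[nu]_y (y - m) +
     u ^+ 2 / 2 * \int[nu]_y ((y - m) ^+ 2))| <=
  `|u| ^+ 3 * \int[nu]_y (`|y - m| ^+ 3 * expR (a / 2 * `|y - m|)).
Proof.
move=> ua.
have i0 : nu.-integrable setT (EFin \o (fun=> 1 : R)).
  apply: eq_integrable (integrable_pow m 0) => // y _ /=; by rewrite expr0.
have i1 : nu.-integrable setT (EFin \o (fun y => y - m)).
  by apply: eq_integrable (integrable_pow m 1).
have i2 := integrable_pow m 2.
have iu1 : nu.-integrable setT (EFin \o (fun y => u * (y - m))).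
  exact: (integrableZl _ u i1).
have iu2 : nu.-integrable setT (EFin \o (fun y => u ^+ 2 / 2 * (y - m) ^+ 2)).
  exact: (integrableZl _ (u ^+ 2 / 2) i2).
have i01 : nu.-integrable setT (EFin \o (fun y => 1 + u * (y - m))).
  exact: (integrableD _ i0 iu1).
have i012 : nu.-integrable setT
    (EFin \o (fun y => 1 + u * (y - m) + u ^+ 2 / 2 * (y - m) ^+ 2)).
  exact: (integrableD _ i01 iu2).
have ie := integrable_cmgf m ua.
have iM := integrable_abs_moment m 3.
rewrite -!RintegralZl// -RintegralD// -RintegralD// -RintegralB//.
apply: le_trans (le_normr_Rintegral _ _) _ => //.
  exact: (integrableB _ ie i012).
apply: le_Rintegral => //.
- by apply: integrable_norm; exact: (integrableB _ ie i012).
- exact: (integrableZl _ _ iM).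
- move=> y _ /=; set z := y - m.
  have -> : expR (u * z) - (1 + u * z + u ^+ 2 / 2 * z ^+ 2) =
    expR (u * z) - 1 - u * z - (u * z) ^+ 2 / 2 by field.
  apply: le_trans (expR_taylor2 _) _.
  rewrite normrM exprMn -(mulrA (`|u| ^+ 3)); apply: ler_wpM2l; first exact: exprn_ge0.
  apply: ler_wpM2l; first exact: exprn_ge0.
  by rewrite ler_expR; exact: ler_wpM2r.
Qed.

(** Used at half the natural parameter, where the first integral is, up to normalisation, the inner
    product of the root density with y - m. *)
Lemma cmgf_deriv_taylor (m u : R) : `|u| <= a / 2 ->
  `|\int[nu]_y ((y - m) * expR (u * (y - m))) - (\int[nu]_y (y - m) +
     u * \int[nu]_y ((y - m) ^+ 2))| <=
  u ^+ 2 * \int[nu]_y (`|y - m| ^+ 3 * expR (a / 2 * `|y - m|)).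
Proof.
move=> ua.
have i1 : nu.-integrable setT (EFin \o (fun y => y - m)).
  by apply: eq_integrable (integrable_pow m 1).
have i2 := integrable_pow m 2.
have iu2 : nu.-integrable setT (EFin \o (fun y => u * (y - m) ^+ 2)).
  exact: (integrableZl _ u i2).
have i12 : nu.-integrable setT (EFin \o (fun y => (y - m) + u * (y - m) ^+ 2)).
  exact: (integrableD _ i1 iu2).
have ie : nu.-integrable setT (EFin \o (fun y => (y - m) * expR (u * (y - m)))).
  by apply: eq_integrable (integrable_moment m 1 ua).
have iM := integrable_abs_moment m 3.
rewrite -!RintegralZl// -RintegralD// -RintegralB//.
apply: le_trans (le_normr_Rintegral _ _) _ => //.
  exact: (integrableB _ ie i12).
apply: le_Rintegral => //.
- by apply: integrable_norm; exact: (integrableB _ ie i12).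
- exact: (integrableZl _ _ iM).
- move=> y _ /=; set z := y - m.
  have -> : z * expR (u * z) - (z + u * z ^+ 2) = z * (expR (u * z) - 1 - u * z).
    by ring.
  rewrite normrM.
  apply: (@le_trans _ _ (`|z| * ((u * z) ^+ 2 * expR `|u * z|))).
    by apply: ler_wpM2l => //; exact: expR_taylor1.
  rewrite exprMn -[z ^+ 2]real_normK ?num_real//.
  have -> : `|z| * (u ^+ 2 * `|z| ^+ 2 * expR `|u * z|) =
    u ^+ 2 * (`|z| ^+ 3 * expR `|u * z|) by ring.
  apply: ler_wpM2l; first exact: sqr_ge0.
  apply: ler_wpM2l; first exact: exprn_ge0.
  by rewrite ler_expR normrM; exact: ler_wpM2r.
Qed.

Lemma cmgf_ge (m u : R) : `|u| <= a / 2 -> \int[nu]_y (y - m) = 0 ->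
  \int[nu]_y 1 <= cmgf m u.
Proof.
move=> ua m0.
have i0 : nu.-integrable setT (EFin \o (fun=> 1 : R)).
  apply: eq_integrable (integrable_pow m 0) => // y _ /=; by rewrite expr0.
have i1 : nu.-integrable setT (EFin \o (fun y => y - m)).
  by apply: eq_integrable (integrable_pow m 1).
have iu1 : nu.-integrable setT (EFin \o (fun y => u * (y - m))).
  exact: (integrableZl _ u i1).
have -> : \int[nu]_y 1 = \int[nu]_y (1 + u * (y - m)).
  by rewrite RintegralD// RintegralZl// m0 mulr0 addr0.
apply: le_Rintegral => //.
- exact: (integrableD _ i0 iu1).
- exact: integrable_cmgf.
- by move=> y _; exact: expR_ge1Dx.
Qed.

End exponential_moments.

(** A vanishing integral would force y = m almost everywhere, making the complement of [m] null. *)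
Lemma nondegenerate_variance (R : realType) (nu : {measure set R -> \bar R})
    (m : R) : (0 < nu [set~ m])%E ->
  nu.-integrable setT (EFin \o (fun y => (y - m) ^+ 2)) ->
  0 < \int[nu]_y ((y - m) ^+ 2).
Proof.
move=> nu_gt0 iv; rewrite lt_neqAle Rintegral_ge0 ?andbT; last first.
  by move=> y _; exact: sqr_ge0.
apply/eqP => v0.
have : (\int[nu]_y `|((y - m) ^+ 2)%:E| = 0)%E.
  transitivity (\int[nu]_y ((y - m) ^+ 2)%:E)%E.
    by apply: eq_integral => y _; rewrite /= ger0_norm// sqr_ge0.
  rewrite -[LHS]fineK; last exact: integrable_fin_num iv.
  by congr EFin; rewrite [RHS]v0.
move/(ae_eq_integral_abs nu measurableT (measurable_int _ iv)) => [N [mN N0 sub]].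
have : (nu [set~ m] <= nu N)%E.
  apply: le_measure; rewrite ?inE//; first exact: measurableC.
  move=> y ym; apply: sub => /= /(_ I) [] /eqP.
  by rewrite sqrf_eq0 subr_eq0 => /eqP.
by rewrite N0 leNgt nu_gt0.
Qed.

Lemma sqrtr_expR (R : realType) (x : R) : Num.sqrt (expR x) = expR (x / 2).
Proof.
have -> : expR x = expR (x / 2) ^+ 2 by rewrite expr2 -expRD -splitr.
by rewrite sqrtr_sqr ger0_norm// expR_ge0.
Qed.

(** Here [x] plays the integral of (y - m) exp (u/2 (y - m)), [A] and [B] the roots of the centred
    mgf at [u] and of the total mass. The error splits into that of [x] and u s/2 (1/A - 1/B), the
    latter small because A^2 - B^2 is of order h^2. *)
Lemma hell_coef_estimate (R : realType) (x V M u h h0 A B s : R) :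
  0 < s -> s ^+ 2 = V -> 0 < B -> B <= A -> 0 <= M -> `|u| <= h -> h <= h0 ->
  `|x - u / 2 * V| <= (u / 2) ^+ 2 * M ->
  A ^+ 2 - B ^+ 2 <= u ^+ 2 / 2 * V + `|u| ^+ 3 * M ->
  `|x / (A * s) - s / B / 2 * u| <=
    (M / (B * s) + h0 * s * (V + h0 * M) / B ^+ 3) * h ^+ 2.
Proof.
move=> s0 sV B0 BA M0 uh hh0 hx hA.
have A0 : 0 < A := lt_le_trans B0 BA.
have h_ge0 : 0 <= h := le_trans (normr_ge0 u) uh.
have V0 : 0 <= V by rewrite -sV sqr_ge0.
have u2 : u ^+ 2 <= h ^+ 2.
  by rewrite -[u ^+ 2]real_normK ?num_real// lerXn2r ?nnegrE.
have u3 : `|u| ^+ 3 <= h ^+ 2 * h0.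
  rewrite exprSr; apply: ler_pM => //; last exact: le_trans hh0.
  by rewrite real_normK ?num_real.
have -> : x / (A * s) - s / B / 2 * u =
    (x - u / 2 * V) / (A * s) + u / 2 * s * (A^-1 - B^-1).
  by rewrite -sV; field; rewrite !gt_eqF.
rewrite [leRHS]mulrDl; apply: le_trans (ler_normD _ _) _; apply: lerD.
- rewrite normrM normfV (gtr0_norm (mulr_gt0 A0 s0)).
  rewrite [leRHS]mulrAC; apply: ler_pM => //; first by rewrite invr_ge0 ltW// mulr_gt0.
    apply: le_trans hx _; rewrite mulrC; apply: ler_wpM2l => //; nra.
  by rewrite lef_pV2 ?posrE ?mulr_gt0// ler_pM2r.
- have AB : `|A^-1 - B^-1| <= h ^+ 2 * (V + h0 * M) / B ^+ 3.
    have -> : A^-1 - B^-1 = - ((A ^+ 2 - B ^+ 2) / (A * B * (A + B))).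
      by field; rewrite !gt_eqF// addr_gt0.
    have AB0 : 0 <= A ^+ 2 - B ^+ 2 by nra.
    have c0 : 0 < A * B * (A + B) by rewrite !mulr_gt0 ?addr_gt0.
    rewrite normrN ger0_norm; last by rewrite divr_ge0// ltW.
    apply: ler_pM => //; first by rewrite invr_ge0 ltW.
      apply: le_trans hA _; nra.
    rewrite lef_pV2 ?posrE ?exprn_gt0//.
    have -> : B ^+ 3 = B * B * B by ring.
    apply: ler_pM; rewrite ?mulr_ge0 ?(ltW B0)//; first by rewrite ler_pM2r.
    by rewrite ler_wpDl// ltW.
  rewrite normrM normrM (gtr0_norm s0) normrM (@gtr0_norm _ 2^-1)//.
  have -> : h0 * s * (V + h0 * M) / B ^+ 3 * h ^+ 2 =
    h0 * s * (h ^+ 2 * (V + h0 * M) / B ^+ 3) by ring.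
  apply: ler_pM => //; first by rewrite !mulr_ge0// ltW.
  rewrite ler_pM2r//; nra.
Qed.

(** [Zm] is the centred mgf at the midpoint. AM-GM replaces sqrt (Zu Zv) by the mean of [Zu] and
    [Zv]; in its difference with [Zm] the quadratic terms combine to V (u - v)^2 / 8 and the cubic
    remainders to at most 2 M h^3. *)
Lemma affinity_estimate (R : realType) (Z Zu Zv Zm V M u v h : R) :
  0 < Z -> Z <= Zu -> Z <= Zv -> 0 <= Zm -> 0 <= M -> 0 <= V ->
  `|u| <= h -> `|v| <= h ->
  Zu <= Z + u ^+ 2 / 2 * V + `|u| ^+ 3 * M ->
  Zv <= Z + v ^+ 2 / 2 * V + `|v| ^+ 3 * M ->
  Z + ((u + v) / 2) ^+ 2 / 2 * V - `|(u + v) / 2| ^+ 3 * M <= Zm ->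
  1 - V / Z * (u - v) ^+ 2 / 8 - 2 * M / Z * h ^+ 3 <=
  Zm / (Num.sqrt Zu * Num.sqrt Zv).
Proof.
move=> Z0 Zu0 Zv0 Zm0 M0 V0 uh vh hu hv hm.
have h0 : 0 <= h := le_trans (normr_ge0 u) uh.
have u3 : `|u| ^+ 3 * M <= h ^+ 3 * M by rewrite ler_wpM2r// lerXn2r ?nnegrE.
have v3 : `|v| ^+ 3 * M <= h ^+ 3 * M by rewrite ler_wpM2r// lerXn2r ?nnegrE.
have m3 : `|(u + v) / 2| ^+ 3 * M <= h ^+ 3 * M.
  rewrite ler_wpM2r// lerXn2r ?nnegrE// normrM (@gtr0_norm _ 2^-1)//.
  have := ler_normD u v; lra.
pose D := (Zu + Zv) / 2; have ZD : Z <= D by rewrite /D; lra.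
have D0 : 0 < D := lt_le_trans Z0 ZD.
pose X := V * (u - v) ^+ 2 / 8 + 2 * M * h ^+ 3.
have X0 : 0 <= X.
  have := mulr_ge0 V0 (sqr_ge0 (u - v)); have := mulr_ge0 M0 (exprn_ge0 3 h0).
  by rewrite /X; lra.
have DX : D - Zm <= X by rewrite /D /X; nra.
apply: (@le_trans _ _ (Zm / D)); last first.
  have su : 0 < Num.sqrt Zu by rewrite sqrtr_gt0; exact: lt_le_trans Zu0.
  have sv : 0 < Num.sqrt Zv by rewrite sqrtr_gt0; exact: lt_le_trans Zv0.
  apply: ler_wpM2l => //; rewrite lef_pV2 ?posrE// ?mulr_gt0//.
  rewrite /D -[in leRHS](sqr_sqrtr (le_trans (ltW Z0) Zu0)).
  rewrite -[in leRHS](sqr_sqrtr (le_trans (ltW Z0) Zv0)).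
  by have := sqr_ge0 (Num.sqrt Zu - Num.sqrt Zv); nra.
have -> : 1 - V / Z * (u - v) ^+ 2 / 8 - 2 * M / Z * h ^+ 3 = 1 - X / Z.
  by rewrite /X; field; rewrite gt_eqF.
apply: (@le_trans _ _ (1 - X / D)).
  by rewrite lerD2l lerN2 ler_wpM2l// lef_pV2 ?posrE.
rewrite ler_pdivlMr// mulrBl mul1r mulfVK ?gt_eqF//; lra.
Qed.

(** * The family in one natural parameter *)

(** [pdens nu theta x] is [edens nu (dotx theta x)] by conversion, so all local estimates concern
    one real parameter. *)
Definition edens (R : realType) (nu : {measure set R -> \bar R}) (u y : R) : R :=
  expR (y * u - logpart nu u).

Section edens_centered.
Variables (R : realType) (nu : {measure set R -> \bar R}) (a : R).
Hypotheses (a0 : 0 < a) (Za : domA nu a) (ZNa : domA nu (- a)).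
Variables (m u : R).
Hypotheses (ua : `|u| <= a / 2) (c0 : 0 < cmgf nu m u).

Lemma ZpartE : Zpart nu u = (expR (u * m) * cmgf nu m u)%:E.
Proof.
have ie := integrable_cmgf a0 Za ZNa m ua.
rewrite EFinM fineK; last exact: integrable_fin_num ie.
rewrite -integralZl//; apply: eq_integral => y _.
by rewrite -EFinM -expRD; congr (expR _)%:E; ring.
Qed.

Lemma edensE y : edens nu u y = expR (u * (y - m)) / cmgf nu m u.
Proof.
rewrite /edens /logpart ZpartE /= lnM ?posrE ?expR_gt0// expRK.
have -> : y * u - (u * m + ln (cmgf nu m u)) = u * (y - m) - ln (cmgf nu m u).
  by ring.
by rewrite expRB lnK ?posrE.
Qed.

Lemma sqrt_edensE y :
  Num.sqrt (edens nu u y) = expR (u / 2 * (y - m)) / Num.sqrt (cmgf nu m u).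
Proof.
rewrite edensE sqrtrM ?expR_ge0// sqrtr_expR sqrtrV ?(ltW c0)//.
by congr (expR _ * _); ring.
Qed.

Lemma integral_edens : (\int[nu]_y (edens nu u y)%:E = 1)%E.
Proof.
have ie := integrable_cmgf a0 Za ZNa m ua.
transitivity (\int[nu]_y ((cmgf nu m u)^-1%:E * (expR (u * (y - m)))%:E))%E.
  by apply: eq_integral => y _; rewrite edensE mulrC EFinM.
rewrite integralZl// -[X in (_ * X)%E]fineK; last exact: integrable_fin_num ie.
by rewrite -EFinM -/(Rintegral _ _ _) -/(cmgf nu m u) mulVf// gt_eqF.
Qed.

Lemma integrable_edens_ln :
  nu.-integrable setT (EFin \o (fun y => edens nu u y * ln (edens nu u y))).
Proof.
have i0 := integrable_cmgf a0 Za ZNa m ua.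
have i1 := integrable_moment a0 Za ZNa m 1 ua.
have := integrableD measurableT (integrableZl measurableT (u / cmgf nu m u) i1)
  (integrableZl measurableT (- (ln (cmgf nu m u) / cmgf nu m u)) i0).
apply: eq_integrable => // y _ /=.
rewrite edensE lnM ?posrE ?expR_gt0 ?invr_gt0// expRK lnV ?posrE//.
rewrite -!EFinM -EFinD; congr EFin; ring.
Qed.

End edens_centered.

(** Condenses what the minimax argument uses of [nu]: [sg] is the standard deviation of the
    normalised base measure, [e] the centred response scaled to unit norm, and [K] bounds the
    remainders of both the Hellinger coefficient and the affinity. *)
Lemma edens_local (R : realType) (nu : {measure set R -> \bar R}) :
  (forall y0 : R, (0 < nu [set~ y0])%E) -> interior (domA nu) 0 ->
  exists (h0 sg K : R) (e : R -> R),
  [/\ 0 < h0, 0 < sg, 0 <= K & (nu setT < +oo)%E] /\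
  [/\ measurable_fun setT e,
      nu.-integrable setT (EFin \o (fun y => e y ^+ 2)),
      \int[nu]_y (e y ^+ 2) = 1 &
  [/\ forall u, `|u| <= h0 -> (\int[nu]_y (edens nu u y)%:E = 1)%E /\
        nu.-integrable setT (EFin \o (fun y => edens nu u y * ln (edens nu u y))),
      forall h u, h <= h0 -> `|u| <= h ->
        `|\int[nu]_y (Num.sqrt (edens nu u y) * e y) - sg / 2 * u| <= K * h ^+ 2 &
      forall h u v, h <= h0 -> `|u| <= h -> `|v| <= h ->
        ((1 - sg ^+ 2 * (u - v) ^+ 2 / 8 - K * h ^+ 3)%:E <=
        \int[nu]_y (Num.sqrt (edens nu u y) * Num.sqrt (edens nu v y))%:E)%E]].
Proof.
move=> nondeg /nbhs_ballP[r /= r0 rA].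
(* Both [a] and [- a] then lie in the ball contained in [domA]. *)
pose a := r / 2; have a0 : 0 < a by rewrite divr_gt0.
have ar : `|a| < r by rewrite gtr0_norm// /a; lra.
have Za : domA nu a by apply: rA; rewrite /ball /= sub0r normrN.
have ZNa : domA nu (- a) by apply: rA; rewrite /ball /= sub0r normrN normrN.
have nufin := fin_measure a0 Za ZNa.
pose Z : R := \int[nu]_y 1.
have Z0 : 0 < Z.
  rewrite /Z Rintegral_cst// mul1r fine_gt0// nufin andbT.
  apply: lt_le_trans (nondeg 0) _; apply: le_measure; rewrite ?inE//.
  exact: measurableC.
have i0 : nu.-integrable setT (EFin \o (fun=> 1 : R)).
  by apply: eq_integrable (integrable_pow a0 Za ZNa 0 0).
have i1 : nu.-integrable setT (EFin \o id).
  apply: eq_integrable (integrable_pow a0 Za ZNa 0 1) => // y _ /=.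
  by rewrite expr1 subr0.
pose m := (\int[nu]_y y) / Z.
have m0 : \int[nu]_y (y - m) = 0.
  have im : nu.-integrable setT (EFin \o (fun=> m)).
    apply: eq_integrable (integrableZl measurableT m i0) => // y _ /=.
    by rewrite mule1.
  rewrite RintegralB//.
  have -> : \int[nu]_y m = m * Z.
    by rewrite /Z -RintegralZl//; apply: eq_Rintegral => y _; rewrite mulr1.
  by rewrite /m mulfVK ?subrr// gt_eqF.
pose V := \int[nu]_y ((y - m) ^+ 2).
have iV := integrable_pow a0 Za ZNa m 2.
have V0 : 0 < V by exact: nondegenerate_variance.
pose M := \int[nu]_y (`|y - m| ^+ 3 * expR (a / 2 * `|y - m|)).
have M0 : 0 <= M.
  by apply: Rintegral_ge0 => y _; rewrite mulr_ge0 ?exprn_ge0 ?expR_ge0.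
pose s := Num.sqrt V; have s0 : 0 < s by rewrite sqrtr_gt0.
have sV : s ^+ 2 = V by rewrite sqr_sqrtr// ltW.
pose B := Num.sqrt Z; have B0 : 0 < B by rewrite sqrtr_gt0.
have BZ : B ^+ 2 = Z by rewrite sqr_sqrtr// ltW.
pose h0 := a / 2; have h00 : 0 < h0 by rewrite divr_gt0.
pose e y := (y - m) / s.
have cge u : `|u| <= h0 -> Z <= cmgf nu m u.
  by move=> uh; exact: (cmgf_ge a0 Za ZNa uh m0).
have cgt0 u : `|u| <= h0 -> 0 < cmgf nu m u.
  by move=> /cge; exact: lt_le_trans.
have ctay u : `|u| <= h0 ->
    `|cmgf nu m u - (Z + u ^+ 2 / 2 * V)| <= `|u| ^+ 3 * M.
  by move=> uh; have := cmgf_taylor a0 Za ZNa m uh; rewrite m0 mulr0 addr0.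
have cle u : `|u| <= h0 -> cmgf nu m u <= Z + u ^+ 2 / 2 * V + `|u| ^+ 3 * M.
  by move=> /ctay; rewrite ler_norml => /andP[_]; lra.
have cge' u : `|u| <= h0 -> Z + u ^+ 2 / 2 * V - `|u| ^+ 3 * M <= cmgf nu m u.
  by move=> /ctay; rewrite ler_norml => /andP[+ _]; lra.
pose K1 := M / (B * s) + h0 * s * (V + h0 * M) / B ^+ 3.
pose K2 := 2 * M / Z.
have K10 : 0 <= K1.
  rewrite /K1 addr_ge0// divr_ge0// ?mulr_ge0 ?addr_ge0 ?exprn_ge0 ?mulr_ge0//;
  exact: ltW.
have K20 : 0 <= K2 by rewrite /K2 divr_ge0 ?mulr_ge0// ltW.
(* [K1] serves the Hellinger coefficient, [K2] the affinity; the sum covers both. *)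
exists h0, (s / B), (K1 + K2), e; split.
  by split=> //; rewrite ?divr_gt0// addr_ge0.
have eE : (fun y => e y ^+ 2) = (fun y => V^-1 * (y - m) ^+ 2).
  by apply/funext => y; rewrite /e expr_div_n sV mulrC.
split.
- by apply: measurable_funM => //; exact: measurable_funB.
- by rewrite eE; exact: (integrableZl measurableT V^-1 iV).
- by rewrite eE RintegralZl// mulVf// gt_eqF.
split.
- move=> u uh; split.
    exact: (integral_edens a0 Za ZNa uh (cgt0 u uh)).
  exact: (integrable_edens_ln a0 Za ZNa uh (cgt0 u uh)).
- move=> h u hh uh; have uh0 : `|u| <= h0 := le_trans uh hh.
  have u2 : `|u / 2| <= h0.
    by rewrite normrM (@gtr0_norm _ 2^-1)//; have := normr_ge0 u; lra.
  have ix : nu.-integrable setT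
      (EFin \o (fun y => (y - m) * expR (u / 2 * (y - m)))).
    by apply: eq_integrable (integrable_moment a0 Za ZNa m 1 u2).
  have -> : \int[nu]_y (Num.sqrt (edens nu u y) * e y) =
      \int[nu]_y ((y - m) * expR (u / 2 * (y - m))) /
        (Num.sqrt (cmgf nu m u) * s).
    rewrite -RintegralZr//; apply: eq_Rintegral => y _.
    rewrite (sqrt_edensE a0 Za ZNa uh0 (cgt0 u uh0)) /e invfM; ring.
  apply: (@le_trans _ _ (K1 * h ^+ 2)); last first.
    by rewrite ler_wpM2r ?sqr_ge0// lerDl.
  apply: (hell_coef_estimate s0 sV B0 _ M0 uh hh).
  + by apply: ler_wsqrtr; exact: cge.
  + by have := cmgf_deriv_taylor a0 Za ZNa m u2; rewrite m0 add0r.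
  + by rewrite BZ (sqr_sqrtr (ltW (cgt0 u uh0))); have := cle u uh0; lra.
- move=> h u v hh uh vh.
  have uh0 : `|u| <= h0 := le_trans uh hh; have vh0 : `|v| <= h0 := le_trans vh hh.
  have mh0 : `|(u + v) / 2| <= h0.
    by rewrite normrM (@gtr0_norm _ 2^-1)//; have := ler_normD u v; lra.
  (* The product of two root densities is, up to normalisation, the exponential at the midpoint
     parameter. *)
  have -> : (\int[nu]_y (Num.sqrt (edens nu u y) * Num.sqrt (edens nu v y))%:E =
     (cmgf nu m ((u + v) / 2) /
       (Num.sqrt (cmgf nu m u) * Num.sqrt (cmgf nu m v)))%:E)%E.
    have im := integrable_cmgf a0 Za ZNa m mh0.
    rewrite mulrC EFinM fineK; last exact: integrable_fin_num im.
    rewrite -integralZl//; apply: eq_integral => y _.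
    rewrite -EFinM; congr EFin.
    transitivity (expR (u / 2 * (y - m)) / Num.sqrt (cmgf nu m u) *
        (expR (v / 2 * (y - m)) / Num.sqrt (cmgf nu m v))).
      congr (_ * _).
      - exact: (sqrt_edensE a0 Za ZNa uh0 (cgt0 u uh0)).
      - exact: (sqrt_edensE a0 Za ZNa vh0 (cgt0 v vh0)).
    rewrite mulrACA -expRD invfM mulrC; congr (_ * expR _); ring.
  rewrite lee_fin.
  have -> : (s / B) ^+ 2 = V / Z by rewrite expr_div_n sV BZ.
  apply: le_trans (affinity_estimate Z0 (cge u uh0) (cge v vh0)
    (ltW (cgt0 _ mh0)) M0 (ltW V0) uh vh (cle u uh0) (cle v vh0) (cge' _ mh0)).
  rewrite lerD2l lerN2 -/K2 ler_wpM2r ?lerDr// exprn_ge0//.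
  exact: le_trans uh.
Qed.

(** * The parameter cube and the choice of its scale *)

Lemma bernoulli_ineq (R : realType) (x : R) n : 0 <= x -> x <= 1 ->
  1 - n%:R * x <= (1 - x) ^+ n.
Proof.
move=> x0 x1; elim: n => [|n IH]; first by rewrite mul0r subr0 expr0.
rewrite exprS -natr1; apply: le_trans (_ : (1 - x) * (1 - n%:R * x) <= _).
  by have n0 : 0 <= n%:R :> R := ler0n _ _; nra.
by apply: ler_wpM2l => //; rewrite subr_ge0.
Qed.

Lemma cube_coef_dist (R : realType) d (w w' : Xd d -> R) (C : R) i :
  (forall x, `|w x - w' x| <= C) -> `|cube_coef w i - cube_coef w' i| <= C.
Proof.
move=> wC; have N0 := card_Xd_gt0 R d.
rewrite /cube_coef -mulrBr -sumrB normrM normfV (gtr0_norm N0).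
rewrite mulrC ler_pdivrMr//; apply: le_trans (ler_norm_sum _ _ _) _.
rewrite mulr_natr -sumr_const; apply: ler_sum => x _.
by rewrite -mulrBr normrM normr_xcoord mul1r.
Qed.

Definition cube_theta (R : realType) d (ep : R) (t : Xd d) : 'rV[R]_d :=
  \row_i (ep * xcoord R t i).

Lemma dotx_cube_theta_le (R : realType) d (ep : R) (t x : Xd d) : 0 <= ep ->
  `|dotx (cube_theta ep t) x| <= d%:R * ep.
Proof.
move=> ep0; apply: le_trans (ler_norm_sum _ _ _) _.
rewrite mulr_natl -[X in _ *+ X](card_ord d) -sumr_const.
apply: ler_sum => i _; rewrite mxE !normrM !normr_xcoord !mulr1.
by rewrite ger0_norm.
Qed.

Lemma dotx_flip (R : realType) d (ep : R) (t x : Xd d) i :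
  dotx (cube_theta ep t) x - dotx (cube_theta ep (flip i t)) x =
  2 * ep * xcoord R t i * xcoord R x i.
Proof.
rewrite /dotx -sumrB (bigD1 i)//= big1 ?addr0 => [|j ji].
  by rewrite !mxE xcoord_flip eqxx; ring.
by rewrite !mxE xcoord_flip (negbTE ji) subrr.
Qed.

Unset Implicit Arguments.

Theorem theorem2 (R : realType) :
  exists c : R, 0 < c /\
  forall (d : nat) (nu : {measure set R -> \bar R}) (Theta : set 'rV[R]_d),
    (1 <= d)%N ->
    (* nondegenerate base measure: nu is not concentrated on a single point *)
    (forall y0 : R, (0 < nu [set~ y0])%E) ->
    (* 0 lies in the interior of dom A *)
    interior (domA nu) 0 ->
    (* 0 lies in the interior of Theta *)
    interior Theta 0 ->
    (* the model P_theta is well defined (natural parameters inside int dom A) *)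
    (forall theta, Theta theta -> forall x : Xd d, interior (domA nu) (dotx theta x)) ->
    exists N : nat, forall n : nat, (N <= n)%N ->
      ((c * d%:R / n%:R)%:E <= minimax_excess_risk nu Theta n)%E.
Proof.
(* With D = sg ep / 2 and sg^2 ep^2 = 1/(2n), D^2/16 equals 1/(128 n). *)
exists 128^-1; split=> // d nu Theta _ nondeg domA0 /nbhs_ballP[r /= r0 rT] _.
have [h0 [sg [K [e [[h00 sg0 K0 nufin] [me ie e1 [dens proj aff]]]]]]] :=
  edens_local nondeg domA0.
have d0 : 0 <= d%:R :> R := ler0n _ _.
(* Each condition ep q <= 1 secures one smallness requirement: [q1] keeps natural parameters within
   [h0], [q2] keeps the cube in the ball inside [Theta], [q3] controls the error of the Hellinger
   coefficients, [q4] the cubic loss of affinity. *)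
pose q1 : R := d%:R / h0; pose q2 := 2 / r.
pose q3 := 4 * K * d%:R ^+ 2 / sg; pose q4 := 2 * K * d%:R ^+ 3 / sg ^+ 2.
have q10 : 0 <= q1 by rewrite divr_ge0// ltW.
have q20 : 0 < q2 by rewrite divr_gt0.
have q30 : 0 <= q3 by rewrite divr_ge0 ?mulr_ge0 ?exprn_ge0// ltW.
have q40 : 0 <= q4 by rewrite divr_ge0 ?mulr_ge0 ?exprn_ge0// ltW// exprn_gt0.
pose Q := q1 + q2 + q3 + q4; have Q0 : 0 < Q by rewrite /Q; lra.
(* Beyond this threshold 2 n sg^2 exceeds Q^2, that is, ep Q <= 1. *)
exists (Num.truncn (Q ^+ 2 / (2 * sg ^+ 2))).+1 => n Nn.
have sg2 : 0 < sg ^+ 2 by rewrite exprn_gt0.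
have nQ : Q ^+ 2 < n%:R * (2 * sg ^+ 2).
  rewrite -ltr_pdivrMr ?mulr_gt0//; apply: lt_le_trans (truncnS_gt _) _.
  by rewrite ler_nat.
have n0 : 0 < n%:R :> R by rewrite ltr0n; exact: leq_trans Nn.
pose ep : R := (Num.sqrt (n%:R * (2 * sg ^+ 2)))^-1.
have ns0 : 0 < n%:R * (2 * sg ^+ 2) by rewrite !mulr_gt0.
have ep0 : 0 < ep by rewrite invr_gt0 sqrtr_gt0.
have ep2 : sg ^+ 2 * ep ^+ 2 = (2 * n%:R)^-1.
  by rewrite /ep exprVn sqr_sqrtr ?(ltW ns0)//; field; rewrite !gt_eqF.
have epQ : ep * Q <= 1.
  rewrite mulrC ler_pdivrMr ?sqrtr_gt0// mul1r -(ger0_norm (ltW Q0)) -sqrtr_sqr.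
  by apply: ler_wsqrtr; exact: ltW.
have epq (q : R) : q <= Q -> ep * q <= 1.
  by move=> qQ; apply: le_trans epQ; rewrite ler_pM2l.
have c1 : d%:R * ep <= h0.
  have : ep * q1 <= 1 by apply: epq; rewrite /Q; lra.
  by rewrite /q1 mulrA ler_pdivrMr// mul1r mulrC.
have c2 : ep < r.
  have : ep * q2 <= 1 by apply: epq; rewrite /Q; lra.
  rewrite /q2 mulrA ler_pdivrMr// mul1r; lra.
have c3 : 2 * (K * (d%:R * ep) ^+ 2) <= sg * ep / 2.
  have : ep * q3 <= 1 by apply: epq; rewrite /Q; lra.
  rewrite /q3 (mulrA ep) ler_pdivrMr// mul1r => h.
  have := ler_wpM2r (ltW ep0) h; rewrite exprMn; lra.
have c4 : K * (d%:R * ep) ^+ 3 <= sg ^+ 2 * ep ^+ 2 / 2.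
  have : ep * q4 <= 1 by apply: epq; rewrite /Q; lra.
  rewrite /q4 (mulrA ep) ler_pdivrMr// mul1r => h.
  have := ler_wpM2r (sqr_ge0 ep) h; rewrite exprMn; lra.
have dl t x := @dotx_cube_theta_le R d ep t x (ltW ep0).
have dl0 (t x : Xd d) : `|dotx (cube_theta ep t) x| <= h0.
  exact: le_trans (dl t x) c1.
have n1 : (2 * n%:R)^-1 <= 1 :> R.
  rewrite invf_le1 ?mulr_gt0//.
  have : 1 <= n%:R :> R by rewrite ler1n -(ltr0n R).
  lra.
have -> : 128^-1 * d%:R / n%:R = d%:R * (sg * ep / 2) ^+ 2 / 16.
  by rewrite expr_div_n exprMn ep2; field; rewrite gt_eqF.
apply: (@minimax_excess_risk_ge R d nu Theta n (cube_theta ep) e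
  (sg * ep / 2) (1 - (2 * n%:R)^-1)) => //.
- move=> t; apply: rT; split=> // i j; rewrite /ball /= !mxE sub0r normrN normrM.
  by rewrite normr_xcoord mulr1 gtr0_norm.
- move=> t x; have [h1 _] := dens _ (dl0 t x); split=> //.
  + by move=> y; exact: pdens_ge0.
  + exact: measurable_pdens.
- by move=> t x; have [_] := dens _ (dl0 t x).
- by rewrite divr_ge0 ?mulr_ge0// ltW.
- move=> t i.
  pose F s := cube_coef (hell_proj nu e (pdens nu (cube_theta ep s))) i.
  (* [F s] is close to sg ep s_i / 2, so a flip moves it by sg ep up to twice the error, which [c3]
     bounds by half of that. *)
  have hp s : `|F s - sg / 2 * (ep * xcoord R s i)| <= K * (d%:R * ep) ^+ 2.
    have <- : (cube_theta ep s) 0 i = ep * xcoord R s i by rewrite mxE.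
    rewrite -cube_coef_lin; apply: cube_coef_dist => x.
    exact: (proj _ _ c1 (dl s x)).
  change (sg * ep / 2 <= `|F t - F (flip i t)|).
  move: (hp t) (hp (flip i t)); rewrite xcoord_flip eqxx.
  move: (F t) (F (flip i t)) => A B {hp F}.
  rewrite /xcoord; case: (t i).
    rewrite !ler_norml => /andP[? ?] /andP[? ?].
    by apply: le_trans (ler_norm _); lra.
  rewrite !ler_norml => /andP[? ?] /andP[? ?].
  by rewrite distrC; apply: le_trans (ler_norm _); lra.
- by rewrite subr_ge0.
(* Bernoulli: (1 - 1/(2n))^n >= 1 - n/(2n) = 1/2. *)
- apply: le_trans (bernoulli_ineq n _ n1); last by rewrite invr_ge0 ltW// mulr_gt0.
  by rewrite le_eqVlt; apply/orP; left; apply/eqP; field; rewrite gt_eqF.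
(* A flip changes the natural parameter by 2 ep in absolute value at every [x], costing sg^2 ep^2 /
   2; by [c4] the remainder costs no more, and the total is at most 1/(2n). *)
- move=> i t x; apply: le_trans (aff _ _ _ c1 (dl t x) (dl (flip i t) x)).
  rewrite lee_fin dotx_flip !exprMn !xcoord_sqr !mulr1; lra.
Qed.
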